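(* Let $2\le k\le n-1$, let $A=C_n^k$, and let $D(n,k)$ be the digraph with vertex set $[n]$ and arcs of the form $(i,i+k)$ and $(i,i-1)$ for all $i\in[n]$ (indices modulo $n$). Let $s,p$ be integers with $2\le p\le s-1$ and let $a=\gcd(s,p)$. Then $A$ has a circulant minor $C_s^p$ (i.e. there is $N\subseteq[n]$ with $C_n^k/N\approx C_s^p$) if and only if there is a family $\Gamma=\{\Gamma^i : i\in[a]\}$ of pairwise vertex-disjoint circuits in $D(n,k)$, each of them having $\frac{s}{a}$ row arcs and winding number $\frac{p}{a}$. Moreover, if $\Gamma$ is such a family, $B$ is the set of essential bullets of $\Gamma$ and $N=[n]\setminus B$, then $C_n^k/N\approx C_s^p$.
   Context: For $n\in\mathbb N$, $[n]$ denotes $\{1,\dots,n\}$ with addition modulo $n$. For $x,y\in[n]$, $y-x$ denotes the least integer $t\ge 0$ with $x+t\equiv y \pmod n$; $[x,y]_n=\{x+r : 0\le r\le y-x\}$ and $[x,y)_n=[x,y]_n\setminus\{y\}$. For $2\le k\le n-1$, the circulant matrix $C_n^k$ is the $n\times n$ $\{0,1\}$-matrix whose $i$-th row is the incidence vector of $[i,i+k)_n$. Two matrices are isomorphic, written $A\approx A'$, if one is obtained from the other by permuting rows and columns. A row dominates another row if its support contains the support of the other; a row is dominating if it dominates some other row. For $N\subseteq[n]$, the minor $A/N$ is obtained from $A$ by removing all columns with indices in $N$ and then all dominating rows (among identical rows one copy is kept). In $D(n,k)$, the arcs $(i,i+k)$ are called row arcs and have length $k$; the arcs $(i,i-1)$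 are called reverse short arcs and have length $-1$. Parallel arcs of different types (when $k=n-1$) are regarded as distinct. Circuits are simple directed circuits. The winding number of a circuit is the sum of the lengths of its arcs divided by $n$. An essential bullet of a circuit $\Gamma'$ in $D(n,k)$ is a vertex of $\Gamma'$ that is not the tail of a reverse short arc of $\Gamma'$. The set of essential bullets of a family of vertex-disjoint circuits is the union of the sets of essential bullets of its members. *)

(* Defs.v *)
From mathcomp Require Import all_boot all_order all_fingroup all_algebra.

Set Implicit Arguments.
Unset Strict Implicit.
Unset Printing Implicit Defensive.

Import GRing.Theory Num.Theory.

(* The index set [n] is represented by 'I_n = {0, ..., n-1} with cyclic       *)
(* successor [ordS] and predecessor [ord_pred] modulo n.                      *)

Definition cadd (n : nat) (x : 'I_n) (r : nat) : 'I_n := iter r (@ordS n) x.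

(* [findex ordS x y] is the least t >= 0 with x + t = y modulo n. *)
Definition cdist (n : nat) (x y : 'I_n) : nat := findex (@ordS n) x y.

Definition citv (n : nat) (x y : 'I_n) : {set 'I_n} :=
  [set cadd x r | r : 'I_(cdist x y).+1].

Definition citvo (n : nat) (x y : 'I_n) : {set 'I_n} := citv x y :\ y.

(* {0,1}-matrices are boolean matrices. *)
Definition circulant (n k : nat) : 'M[bool]_n :=
  \matrix_(i, j) (j \in citvo i (cadd i k)).

Definition mx_isomorphic (m n m' n' : nat)
    (A : 'M[bool]_(m, n)) (A' : 'M[bool]_(m', n')) : Prop :=
  exists (e : (m = m') * (n = n')) (s : 'S_m') (t : 'S_n'),
    A' = row_perm s (col_perm t (castmx e A)).

Definition row_supp (m n : nat) (A : 'M[bool]_(m, n)) (i : 'I_m) : {set 'I_n} :=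
  [set j | A i j].

Definition dominates (m n : nat) (A : 'M[bool]_(m, n)) (i j : 'I_m) : bool :=
  row_supp A j \subset row_supp A i.

(* Row i survives iff every row it dominates is identical to it and does not  *)
(* precede it: the copy kept among identical rows is the first one.           *)
Definition kept_rows (m n : nat) (A : 'M[bool]_(m, n)) : {set 'I_m} :=
  [set i | [forall j, dominates A i j ==> dominates A j i && (i <= j)]].

Definition del_dominating (m n : nat) (A : 'M[bool]_(m, n)) :
    'M[bool]_(#|kept_rows A|, n) :=
  rowsub (fun i : 'I_#|kept_rows A| => enum_val i) A.

Definition del_cols (m n : nat) (A : 'M[bool]_(m, n)) (N : {set 'I_n}) :
    'M[bool]_(m, #|~: N|) :=
  colsub (fun j : 'I_#|~: N| => enum_val j) A.

Definition mx_minor (m n : nat) (A : 'M[bool]_(m, n)) (N : {set 'I_n}) :=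
  del_dominating (del_cols A N).

(* An arc of D(n,k) is its tail together with its type, so that parallel arcs *)
(* of different types are distinct: (i, true) is the row arc (i, i+k) and     *)
(* (i, false) is the reverse short arc (i, i-1).                              *)
Definition darc (n : nat) : Type := ('I_n * bool)%type.

Definition is_row_arc (n : nat) (e : darc n) : bool := e.2.

Definition arc_tail (n : nat) (e : darc n) : 'I_n := e.1.

Definition arc_head (n k : nat) (e : darc n) : 'I_n :=
  if is_row_arc e then cadd (arc_tail e) k else ord_pred (arc_tail e).

Definition arc_length (n k : nat) (e : darc n) : int :=
  if is_row_arc e then Posz k else (-1)%R.

(* A circuit is the cyclic sequence of its arcs, which is determined up to    *)
(* rotation; simple means that no vertex is repeated.                         *)
Definition circuit (n k : nat) (c : seq (darc n)) : bool :=
  [&& c != [::],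
      path.cycle (fun e f => arc_head k e == arc_tail f) c
    & uniq [seq arc_tail e | e <- c]].

Definition vertices (n : nat) (c : seq (darc n)) : {set 'I_n} :=
  [set v in [seq arc_tail e | e <- c]].

Definition winding (n k : nat) (c : seq (darc n)) : rat :=
  ((\sum_(e <- c) arc_length k e)%:~R / n%:R)%R.

Definition essential_bullets (n : nat) (c : seq (darc n)) : {set 'I_n} :=
  [set v in vertices c | (v, false) \notin c].

Definition family_bullets (n a : nat) (G : 'I_a -> seq (darc n)) : {set 'I_n} :=
  \bigcup_(i < a) essential_bullets (G i).

Definition circuit_family (n k s p : nat)
    (G : 'I_(gcdn s p) -> seq (darc n)) : Prop :=
  (forall i, [/\ circuit k (G i),
                 count (@is_row_arc n) (G i) = s %/ gcdn s p
               & winding k (G i) = (p %/ gcdn s p)%:R%R]) /\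
  (forall i j, i != j -> [disjoint vertices (G i) & vertices (G j)]).

Arguments circuit_family n k s p G : clear implicits.

(* Main.v *)
Require Import Defs.
From mathcomp Require Import all_boot all_order all_fingroup all_algebra.
From mathcomp Require Import zify.

(** Both sides of the equivalence are conditions on the set [B] of columns
    that are kept, and they turn out to be the same condition.

    Unroll the cycle: for a natural number [x] let [hits B x] count the
    [y < x] whose residue lies in [B]. Call [B] balanced with excess [p] when
    every window of [k] consecutive indices that starts just after an element
    of [B] contains exactly [p] elements of [B].

    On the matrix side, once the columns are restricted to [B] and read in
    cyclic order, row [i] is the cyclic interval of [B] that starts at
    [hits B i] and has length [hits B (i + k) - hits B i]. A matrix whose rows
    are cyclic intervals of a cycle of length [s] reduces to [C_s^p] exactly
    when no row is shorter than [p] and each of the [s] intervals of length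
    [p] is a row ([isomorphic_cyc_itv]); this is balance
    ([minor_circulantP]).

    On the circuit side, the row arc leaving [b] in [B] is followed by reverse
    short arcs from [b + k] down to the last element of [B] that is at most
    [b + k]. Disjoint circuits make these stopping elements strictly increasing
    with [b] ([family_lt_next]), hence the number of elements of [B] among
    [b + 1 .. b + k] is nondecreasing along the unrolled cycle; being periodic
    it is constant ([balanced_of_lt]). If it equals [q], then a circuit with
    [r] row arcs and winding number [w] satisfies [q * r = #|B| * w]
    ([circuit_winding]), because on a closed walk positions and bullets are
    counted by the same number of turns; with [r = s/a], [w = p/a] and
    [#|B| = s] this gives [q = p].

    Conversely, let [B] be balanced with excess [p]. The walk that jumps from
    elements of [B] and steps back from the others is injective on the orbit
    of every element of [B], so these orbits are circuits ([tour_closed]). The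
    walk preserves the rank in [B] modulo [a = gcd(s, p)], so the orbits of the
    first [a] elements of [B] are disjoint. By the winding identity [s] divides
    [p * r], hence each of them has at least [s/a] row arcs; as there are only
    [s] elements of [B], each has exactly [s/a], and winding number [p/a]
    ([balanced_family]). *)

Set Implicit Arguments.
Unset Strict Implicit.
Unset Printing Implicit Defensive.

Import GRing.Theory Num.Theory.

(** * Circulant matrices and cyclic distance *)

(** [cdist] in a closed form that linear arithmetic can handle. *)
Definition offset (n i j : nat) : nat := if i <= j then j - i else j + n - i.

Lemma val_cadd (n : nat) (i : 'I_n) (r : nat) : cadd i r = (i + r) %% n :> nat.
Proof.
elim: r => [|r IHr]; first by rewrite addn0 modn_small.
by rewrite /cadd iterS /= -/(cadd i r) IHr -addn1 modnDml addn1 addnS.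
Qed.

Lemma cadd_offset (n : nat) (i j : 'I_n) : cadd i (offset n i j) = j.
Proof.
apply: val_inj; rewrite /= val_cadd /offset.
have ltin := ltn_ord i; have ltjn := ltn_ord j.
case: leqP => hij; first by rewrite subnKC // modn_small.
have -> : i + (j + n - i) = j + n by lia.
by rewrite modnDr modn_small.
Qed.

Lemma offset_cadd (n : nat) (i : 'I_n) (r : nat) :
  r < n -> offset n i (cadd i r) = r.
Proof.
move=> ltrn; have ltin := ltn_ord i; rewrite val_cadd /offset.
case: (ltnP (i + r) n) => h; first by rewrite modn_small // leq_addr addKn.
have -> : (i + r) %% n = i + r - n.
  by rewrite -[in LHS](subnK h) modnDr modn_small //; lia.
case: leqP; lia.
Qed.

Lemma cdist_cadd (n : nat) (i : 'I_n) (r : nat) :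
  r < n -> cdist i (cadd i r) = r.
Proof.
move=> ltrn; apply: findex_iter.
suff -> : fingraph.order (@ordS n) i = n by [].
rewrite -[RHS](card_ord n); apply: eq_card => j.
by rewrite -(cadd_offset i j) !inE fconnect_iter.
Qed.

Lemma circulantE (n k : nat) (i j : 'I_n) :
  k < n -> circulant n k i j = (offset n i j < k).
Proof.
move=> ltkn; rewrite mxE in_setD1 /citv cdist_cadd //.
apply/andP/idP => [[neq /imsetP[r _ defj]]|ltd].
  have ltr := ltn_ord r; move: neq; rewrite defj offset_cadd; last by lia.
  by rewrite ltn_neqAle -ltnS ltr andbT; apply: contraNneq => ->.
split; first by apply: contraTneq ltd => ->; rewrite offset_cadd // ltnn.
apply/imsetP; exists (inord (offset n i j)) => //.
by rewrite inordK ?cadd_offset //; lia.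
Qed.

(** * Counting the bullets along the unrolled cycle *)

(** The argument runs over all naturals, so that a window of the cycle that
    passes 0 is still an ordinary interval and cardinals of windows become
    differences of [hits]. *)
Definition hits (n : nat) (B : {set 'I_n.+1}) (x : nat) : nat :=
  \sum_(y < x) (inZp y \in B).

Lemma inZpDn (n y : nat) : inZp (y + n.+1) = inZp y :> 'I_n.+1.
Proof. by apply: val_inj; rewrite /= modnDr. Qed.

Lemma inZpDmul (n q y : nat) : inZp (y + q * n.+1) = inZp y :> 'I_n.+1.
Proof. by apply: val_inj; rewrite /= addnC modnMDl. Qed.

Lemma cadd_inZp (n y r : nat) : cadd (inZp y : 'I_n.+1) r = inZp (y + r).
Proof. by apply: val_inj; rewrite /= val_cadd /= modnDml. Qed.

Lemma ord_pred_inZp (n y : nat) : ord_pred (inZp y.+1 : 'I_n.+1) = inZp y.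
Proof.
apply: val_inj => /=.
rewrite addnS /= -[in RHS]modnDr -[in RHS]addSnnS.
by rewrite -[in LHS]modnDml modn_mod modnDml.
Qed.

Lemma hitsS (n : nat) (B : {set 'I_n.+1}) (x : nat) :
  hits B x.+1 = hits B x + (inZp x \in B).
Proof. by rewrite /hits big_ord_recr. Qed.

Lemma leq_hits (n : nat) (B : {set 'I_n.+1}) (x y : nat) :
  x <= y -> hits B x <= hits B y.
Proof.
move/subnK <-; elim: (y - x) => [|d IHd]; first by [].
by rewrite addSn hitsS; apply: leq_trans IHd (leq_addr _ _).
Qed.

Lemma ltn_hits (n : nat) (B : {set 'I_n.+1}) (x y : nat) :
  inZp x \in B -> (hits B x < hits B y) = (x < y).
Proof.
move=> Bx; case: (ltnP x y) => [ltxy|leyx].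
  by apply: leq_trans (leq_hits B ltxy); rewrite hitsS Bx addn1.
by apply/negbTE; rewrite -leqNgt leq_hits.
Qed.

Lemma hits_period (n : nat) (B : {set 'I_n.+1}) : hits B n.+1 = #|B|.
Proof.
rewrite -sum1_card /hits [RHS]big_mkcond /=; apply: eq_bigr => v _.
by rewrite valZpK; case: ifP.
Qed.

Lemma hitsDn (n : nat) (B : {set 'I_n.+1}) (x : nat) :
  hits B (x + n.+1) = hits B x + #|B|.
Proof.
elim: x => [|x IHx]; first by rewrite add0n hits_period /hits big_ord0.
by rewrite addSn !hitsS IHx inZpDn addnAC.
Qed.

Lemma hitsDmul (n : nat) (B : {set 'I_n.+1}) (q x : nat) :
  hits B (x + q * n.+1) = hits B x + q * #|B|.
Proof.
elim: q => [|q IHq]; first by rewrite !mul0n !addn0.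
by rewrite mulSn addnCA addnC hitsDn IHq mulSn -addnA [_ + #|B|]addnC.
Qed.

Lemma hits_divmod (n : nat) (B : {set 'I_n.+1}) (x d : nat) :
  hits B (x + d) = hits B (x %% n.+1 + d) + x %/ n.+1 * #|B|.
Proof. by rewrite {1}(divn_eq x n.+1) -hitsDmul; congr hits; lia. Qed.

(** [hits] starts at 0 and grows by at most one at each step, so it meets every
    intermediate value, and it does so just after an element of [B]. *)
Lemma hits_ivt (n : nat) (B : {set 'I_n.+1}) (x t : nat) :
  0 < t <= hits B x ->
  exists y, [/\ y < x, inZp y \in B & hits B y.+1 = t].
Proof.
elim: x => [|x IHx]; first by rewrite /hits big_ord0; lia.
rewrite hitsS => /andP[t0 tle]; case: (leqP t (hits B x)) => h.
  by case: IHx => [|y [lt By defy]]; [rewrite t0 | exists y; split=> //; lia].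
exists x; rewrite hitsS.
by move: tle h; case: (inZp x \in B) => //= *; split=> //; lia.
Qed.

(** Among the rows whose first element of [B] is the one following [y], row
    [y + 1] has the smallest support, so these are the rows that decide which
    intervals of [B] are minimal. *)
Definition balanced (n k : nat) (B : {set 'I_n.+1}) (q : nat) : Prop :=
  forall y, inZp y \in B -> hits B (y.+1 + k) = hits B y.+1 + q.

(** * Isomorphism and removal of dominating rows *)

Lemma mx_isomorphicP (m n m' n' : nat)
    (A : 'M[bool]_(m, n)) (A' : 'M[bool]_(m', n')) :
  mx_isomorphic A A' <->
  exists (f : 'I_m' -> 'I_m) (g : 'I_n' -> 'I_n),
    [/\ bijective f, bijective g & forall i j, A' i j = A (f i) (g j)].
Proof.
split=> [[[em en]] | [f [g [bij_f bij_g defA']]]].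
  case: m' / em A' => A'; case: n' / en A' => A' [s [t ->]].
  exists s, t; split; try exact: injF_bij perm_inj.
  by move=> i j; rewrite !mxE castmx_id.
have em : m' = m by have := bij_eq_card bij_f; rewrite !card_ord.
have en : n' = n by have := bij_eq_card bij_g; rewrite !card_ord.
subst m' n'; exists (erefl m, erefl n).
exists (perm (bij_inj bij_f)), (perm (bij_inj bij_g)).
by apply/matrixP => i j; rewrite !mxE castmx_id !permE.
Qed.

Lemma keptP (m n : nat) (A : 'M[bool]_(m, n)) (i j : 'I_m) :
  i \in kept_rows A -> dominates A i j -> dominates A j i /\ i <= j.
Proof. by rewrite inE => /forallP/(_ j)/implyP kept /kept /andP. Qed.

(** Take a dominated row with the fewest entries and, among those, the least
    index. *)
Lemma dominates_kept (m n : nat) (A : 'M[bool]_(m, n)) (i : 'I_m) :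
  exists2 j, j \in kept_rows A & dominates A i j.
Proof.
(* Since j < m, this weight compares (size, index) lexicographically. *)
pose wt (j : 'I_m) := #|row_supp A j| * m + j.
have dom_ii : dominates A i i by exact: subxx.
case: (arg_minnP wt dom_ii) => j dom_ij min_j; exists j => //.
rewrite inE; apply/forallP => j'; apply/implyP => dom_jj'.
have := min_j j' (subset_trans dom_jj' dom_ij); rewrite /wt => le_wt.
have le_c := subset_leq_card dom_jj'; have ltj' := ltn_ord j'.
have eq_c : #|row_supp A j'| = #|row_supp A j|.
  apply/eqP; rewrite eqn_leq le_c leqNgt; apply/negP => lt_c.
  have := leq_mul lt_c (leqnn m); rewrite mulSn; lia.
have eqs : row_supp A j' = row_supp A j.
  by apply/eqP; rewrite eqEcard eq_c leqnn andbT; exact: dom_jj'.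
by rewrite /dominates eqs subxx; move: le_wt; rewrite eqs leq_add2l.
Qed.

(** * Matrices whose rows are cyclic intervals *)

Definition cyc_itv (s : nat) (a : 'I_s) (l : nat) : {set 'I_s} :=
  [set j : 'I_s | offset s a j < l].

Lemma cyc_itvS (s : nat) (a : 'I_s) (l l' : nat) :
  l <= l' -> cyc_itv a l \subset cyc_itv a l'.
Proof. by move=> lell'; apply/subsetP => j; rewrite !inE => /leq_trans ->. Qed.

Lemma card_cyc_itv (s : nat) (a : 'I_s) (l : nat) :
  l <= s -> #|cyc_itv a l| = l.
Proof.
move=> lels; rewrite -[RHS]card_ord.
pose w (r : 'I_l) := cadd a r.
have w_inj : injective w.
  move=> r r' /(congr1 (fun j : 'I_s => offset s a j)) /=.
  by rewrite !offset_cadd ?(leq_trans (ltn_ord _)) // => /val_inj.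
rewrite -(card_codom w_inj); apply: eq_card => j; rewrite inE.
apply/idP/codomP => [ltl | [r ->]]; last first.
  by rewrite offset_cadd ?(leq_trans (ltn_ord _)).
by exists (Ordinal ltl); rewrite /w /= cadd_offset.
Qed.

(** If [a'] is at distance [d > 0] from [a] within the interval, then so is
    the predecessor of [a']; but an interval from [a'] that is not the whole
    cycle misses that predecessor. *)
Lemma cyc_itv_inj (s : nat) (a a' : 'I_s) (l : nat) :
  0 < l < s -> cyc_itv a l = cyc_itv a' l -> a = a'.
Proof.
move=> /andP[l0 ltls] eqI; apply/eqP/negPn/negP => neq.
pose d := offset s a a'.
have ltd : d < l.
  have : a' \in cyc_itv a' l by rewrite inE /offset leqnn subnn.
  by rewrite -eqI inE.
have d0 : 0 < d.
  rewrite lt0n; apply: contraNneq neq => d0.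
  by rewrite -[in X in _ == X](cadd_offset a a') -/d d0.
have : cadd a d.-1 \in cyc_itv a l by rewrite inE offset_cadd; lia.
rewrite eqI inE.
have -> : cadd a d.-1 = cadd a' s.-1.
  apply: val_inj; rewrite /= val_cadd -(cadd_offset a a') -/d !val_cadd modnDml.
  have -> : a + d + s.-1 = a + d.-1 + s by lia.
  by rewrite modnDr.
by rewrite offset_cadd; lia.
Qed.

(** If the reduced matrix is [C_s^p], its rows have size [p] and, being
    distinct intervals of equal length, have distinct starting points; as
    there are [s] of them every starting point occurs, and every row contains
    one of them. Conversely, when all intervals of length [p] occur and no row
    is shorter, the kept rows are one copy of each of these intervals. *)
Lemma isomorphic_cyc_itv (m n s p : nat) (M : 'M[bool]_(m, n))
    (start : 'I_m -> 'I_s) (len : 'I_m -> nat) (g : 'I_n -> 'I_s) :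
  0 < p < s -> bijective g -> (forall i, len i <= s) ->
  (forall i j, M i j = (g j \in cyc_itv (start i) (len i))) ->
  mx_isomorphic (del_dominating M) (circulant s p) <->
  (forall i, p <= len i) /\ (forall a, exists2 i, start i = a & len i = p).
Proof.
move=> lt0ps bij_g len_s defM; have [p0 ltps] := andP lt0ps.
have suppE i : row_supp M i = g @^-1: cyc_itv (start i) (len i).
  by apply/setP => j; rewrite inE defM [RHS]inE.
have card_supp i : #|row_supp M i| = len i.
  by rewrite suppE on_card_preimset ?card_cyc_itv //; exact: onW_bij.
have domE i i' : dominates M i i' =
    (cyc_itv (start i') (len i') \subset cyc_itv (start i) (len i)).
  have [g' _ g'K] := bij_g; rewrite /dominates !suppE.
  apply/idP/idP => [/subsetP sub|]; last exact: preimsetS.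
  by apply/subsetP => c; have := sub (g' c); rewrite !inE !g'K.
split=> [/mx_isomorphicP[f [h [bij_f bij_h defC]]] | [len_p surj]].
  pose kept_row r := enum_val (f r).
  have kept r : kept_row r \in kept_rows M by exact: enum_valP.
  have len_kept r : len (kept_row r) = p.
    rewrite -card_supp -(card_cyc_itv r (ltnW ltps)).
    rewrite -(on_card_preimset (f := h)); last exact: onW_bij.
    by apply: eq_card => c; rewrite !inE -circulantE // defC mxE.
  have start_inj : injective (start \o kept_row).
    move=> r r' /= eqs; apply/(bij_inj bij_f)/enum_val_inj/val_inj/eqP.
    rewrite -/(kept_row r) -/(kept_row r') eqn_leq.
    have dom x y : start (kept_row x) = start (kept_row y) ->
        dominates M (kept_row x) (kept_row y).
      by rewrite domE !len_kept => ->.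
    by have [_ ->] := keptP (kept r) (dom r r' eqs);
       have [_ ->] := keptP (kept r') (dom r' r (esym eqs)).
  split=> [i | a].
    have [j kept_j] := dominates_kept M i.
    rewrite domE => /subset_leq_card; rewrite !card_cyc_itv //.
    have [f' _ f'K] := bij_f; apply: leq_trans.
    rewrite -(len_kept (f' (enum_rank_in kept_j j))) /kept_row f'K.
    by rewrite enum_rankK_in.
  have [k _ kK] := injF_bij start_inj.
  by exists (kept_row (k a)); [exact: (kK a) | exact: len_kept].
have /fin_all_exists[f fP] (a : 'I_s) :
    exists r : 'I_#|kept_rows M|,
      start (enum_val r) = a /\ len (enum_val r) = p.
  have [i start_i len_i] := surj a.
  have [j kept_j dom_ij] := dominates_kept M i.
  exists (enum_rank_in kept_j j); rewrite enum_rankK_in //.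
  move: dom_ij; rewrite domE start_i len_i => sub.
  have len_j : len j = p.
    have := subset_leq_card sub; rewrite !card_cyc_itv ?(ltnW ltps) //.
    by have := len_p j; lia.
  split=> //; apply: (cyc_itv_inj lt0ps).
  apply/eqP; rewrite eqEcard !card_cyc_itv ?(ltnW ltps) //.
  by rewrite -{1}len_j sub leqnn.
have [g' gK g'K] := bij_g.
apply/mx_isomorphicP; exists f, g'; split.
- exists (fun r => start (enum_val r)) => [a | r]; first by case: (fP a).
  apply/enum_val_inj/val_inj/eqP; rewrite eqn_leq.
  set a := start _; have [fa la] := fP a.
  have kept_f := enum_valP (f a); have kept_r := enum_valP r.
  have dom_rf : dominates M (enum_val r) (enum_val (f a)).
    by rewrite domE fa la; exact: cyc_itvS.
  have [dom_fr ->] := keptP kept_r dom_rf.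
  by have [_ ->] := keptP kept_f dom_fr.
- by exists g.
- move=> i j; rewrite circulantE // mxE defM inE g'K.
  by case: (fP i) => -> ->.
Qed.

(** * Circulant minors of a circulant matrix *)

Lemma hits_lt_card (n : nat) (B : {set 'I_n.+1}) (b : 'I_n.+1) :
  b \in B -> hits B b < #|B|.
Proof. by move=> Bb; rewrite -hits_period ltn_hits // valZpK. Qed.

Lemma hits_le_card (n : nat) (B : {set 'I_n.+1}) (i : 'I_n.+1) :
  hits B i <= #|B|.
Proof. by rewrite -hits_period leq_hits // ltnW. Qed.

Lemma hits_inj (n : nat) (B : {set 'I_n.+1}) :
  {in B &, injective (fun b : 'I_n.+1 => hits B b)}.
Proof.
move=> b c Bb Bc /= eqh; apply/val_inj => /=.
have : (hits B b < hits B c) = (b < c) by rewrite ltn_hits ?valZpK.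
have : (hits B c < hits B b) = (c < b) by rewrite ltn_hits ?valZpK.
rewrite eqh ltnn; lia.
Qed.

(** Passing from positions in the cycle to ranks in [B] preserves membership in
    a window, since [hits] is strictly increasing on [B] and counts [#|B|] per
    turn. The reduction modulo [#|B|] matters only when no element of [B] is
    at or after [i], in which case the interval starts at the first element. *)
Lemma offset_hits (n k : nat) (B : {set 'I_n.+1}) (i b : 'I_n.+1) :
  b \in B ->
  (offset n.+1 i b < k) =
  (offset #|B| (hits B i %% #|B|) (hits B b) < hits B (i + k) - hits B i).
Proof.
move=> Bb; have Bb' : inZp b \in B by rewrite valZpK.
have lt_b := hits_lt_card Bb; have le_i := hits_le_card B i.
have ltn := ltn_ord i; have ltb := ltn_ord b.
have mod_i : hits B i %% #|B| = if hits B i == #|B| then 0 else hits B i.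
  case: eqP => [-> | /eqP ne]; first by rewrite modnn.
  by rewrite modn_small // ltn_neqAle ne.
have lt_ik := ltn_hits (i + k) Bb'; have lt_bi := ltn_hits i Bb'.
have lt_bnk : (hits B b + #|B| < hits B (i + k)) = (b + n.+1 < i + k).
  by rewrite -hitsDn ltn_hits // inZpDn.
rewrite mod_i /offset; case: (leqP i b) => leib.
  by case: eqP => eq_i; last case: ifP => le_ib; lia.
case: eqP => eq_i; last by case: ifP => le_ib; lia.
rewrite leq0n; lia.
Qed.

(** For a row [i], let [y] be the last element of [B] before [i]: row [y + 1]
    starts at the same element of [B] and ends no later, so its length bounds
    that of row [i] from below. Conversely any row that starts at the same
    element of [B] as row [y + 1] lies after [y], hence ends no earlier than
    row [y + 1]; if its length is [p], row [y + 1] cannot be longer. *)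
Lemma balancedP (n k p : nat) (B : {set 'I_n.+1}) (B0 : 0 < #|B|) :
  balanced k B p <->
  (forall i : 'I_n.+1, p <= hits B (i + k) - hits B i) /\
  (forall a : 'I_#|B|, exists2 i : 'I_n.+1,
     hits B i %% #|B| = a & hits B (i + k) - hits B i = p).
Proof.
split=> [bal | [lenC surjC] y By].
  split=> [i | a].
    have [|y [ltyi By defy]] := @hits_ivt n B (i + n.+1) (hits B (i + n.+1)).
      by rewrite leqnn hitsDn; lia.
    have := leq_hits B (leq_add ltyi (leqnn k)).
    by rewrite (bal y By) defy addnAC !hitsDn; lia.
  (* Shifting by one turn keeps the rank positive when a = 0. *)
  have [|y [_ By defy]] := @hits_ivt n B (2 * n.+1) (a + #|B|).
    by rewrite -[2 * _]add0n hitsDmul; have := ltn_ord a; lia.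
  exists (inZp y.+1).
    have := hits_divmod B y.+1 0; rewrite !addn0 defy => eqh.
    by rewrite -(modn_small (ltn_ord a)) -[RHS]modnDr eqh addnC modnMDl.
  have := bal y By; have := hits_divmod B y.+1 k.
  have := hits_divmod B y.+1 0; rewrite !addn0 /=; lia.
apply/eqP; rewrite eqn_leq; apply/andP; split; last first.
  have := lenC (inZp y.+1); have := hits_divmod B y.+1 k.
  have := hits_divmod B y.+1 0; rewrite !addn0 /=.
  have := leq_hits B (leq_addr k (y.+1 %% n.+1)); lia.
have [i start_i len_i] := surjC (Ordinal (ltn_pmod (hits B y.+1) B0)).
(* The number of turns that lifts row i to the rank of row y + 1, itself
   shifted by one turn so that the difference is not truncated. *)
pose q := (hits B y.+1 + #|B| - hits B i) %/ #|B|.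
have le_i := hits_le_card B i.
have hits_iq : hits B (i + q * n.+1) = hits B (y.+1 + n.+1).
  rewrite hitsDmul hitsDn divnK; first by lia.
  by rewrite -eqn_mod_dvd; [rewrite modnDr start_i | lia].
have le_yi : y.+1 + n.+1 <= i + q * n.+1.
  rewrite addSn -(@ltn_hits n B); last by rewrite inZpDn.
  by rewrite hits_iq addSn hitsS inZpDn By addn1.
have := leq_hits B (leq_add le_yi (leqnn k)).
rewrite !(addnAC _ _ k) hitsDmul !hitsDn.
move: hits_iq; rewrite hitsDmul hitsDn.
have := leq_hits B (leq_addr k i); lia.
Qed.

(** The isomorphism already forces [s] to be the number of remaining columns;
    ranking these columns by [hits] turns every row into a cyclic interval. *)
Theorem minor_circulantP (n k s p : nat) (N : {set 'I_n.+1}) :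
  k <= n -> 0 < p < s ->
  mx_isomorphic (mx_minor (circulant n.+1 k) N) (circulant s p) <->
  #|~: N| = s /\ balanced k (~: N) p.
Proof.
move=> lekn lt0ps; have s0 : 0 < s by lia.
have [eq_s | ne_s] := eqVneq #|~: N| s; last first.
  by split=> [[[_ en] _] | [en _]]; rewrite en eqxx in ne_s.
subst s; set B := ~: N in lt0ps s0 *; rename s0 into B0.
pose start (i : 'I_n.+1) := Ordinal (ltn_pmod (hits B i) B0).
pose len (i : 'I_n.+1) := hits B (i + k) - hits B i.
pose g (j : 'I_#|B|) := Ordinal (hits_lt_card (enum_valP j)).
have g_inj : injective g.
  move=> j j' /(congr1 val).
  by move=> /(hits_inj (enum_valP j) (enum_valP j'))/enum_val_inj.
have bij_g : bijective g by exact: inj_card_bij.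
have len_s i : len i <= #|B|.
  have := @leq_hits n B (i + k) (i + n.+1); rewrite /len hitsDn; lia.
have defM i j : del_cols (circulant n.+1 k) N i j =
    (g j \in cyc_itv (start i) (len i)).
  by rewrite mxE circulantE // (@offset_hits n k B) ?enum_valP // inE.
have [iso1 iso2] := isomorphic_cyc_itv lt0ps bij_g len_s defM.
have [bal1 bal2] := @balancedP n k p B B0.
split=> [/iso1[lenC surjC] | [_ /bal1[lenC surjC]]].
  split=> //; apply: bal2; split=> // a.
  by have [i start_i len_i] := surjC a; exists i => //; rewrite -start_i.
apply: iso2; split=> // a; have [i start_i len_i] := surjC a.
by exists i => //; apply: val_inj.
Qed.

(** * Circuits *)

Lemma uniq_map_inj (T U : eqType) (f : T -> U) (s : seq T) :
  uniq (map f s) -> {in s &, injective f}.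
Proof.
elim: s => //= x s IHs /andP[fxNs /IHs inj_s] y z.
rewrite !inE => /predU1P[-> | sy] /predU1P[-> | sz] // eqf; last exact: inj_s.
  by case/mapP: fxNs; exists z.
by case/mapP: fxNs; exists y.
Qed.

(** This form of the closing condition makes sums over heads and tails agree,
    and makes heads pairwise distinct because tails are. *)
Lemma circuit_heads (n k : nat) (c : seq (darc n)) :
  circuit k c -> map (@arc_head n k) c = rot 1 (map (@arc_tail n) c).
Proof.
case: c => [|e c] /and3P[] // _ /= cyc _; rewrite rot1_cons -map_rcons.
rewrite -[LHS]/(map (@arc_head n k) (e :: c)) -(belast_rcons e c e).
elim: (rcons c e) {1 3}(e) cyc => [|f s IHs] e' //= /andP[/eqP -> /IHs].
by move=> ->.
Qed.

Lemma sum_heads_tails (n k : nat) (c : seq (darc n)) (F : 'I_n -> int) :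
  circuit k c ->
  (\sum_(e <- c) F (arc_head k e) = \sum_(e <- c) F (arc_tail e))%R.
Proof.
move=> circ_c; rewrite -(big_map (@arc_head n k) xpredT F) circuit_heads //.
rewrite -[RHS](big_map (@arc_tail n) xpredT F).
by apply: perm_big; rewrite perm_rot.
Qed.

Lemma circuit_tail_inj (n k : nat) (c : seq (darc n)) :
  circuit k c -> {in c &, injective (@arc_tail n)}.
Proof. by case/and3P => _ _; apply: uniq_map_inj. Qed.

Lemma circuit_head_inj (n k : nat) (c : seq (darc n)) :
  circuit k c -> {in c &, injective (@arc_head n k)}.
Proof.
move=> circ_c; have [_ _ uniq_c] := and3P circ_c.
by apply: uniq_map_inj; rewrite circuit_heads // rot_uniq.
Qed.

Lemma arc_head_vertex (n k : nat) (c : seq (darc n)) (e : darc n) :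
  circuit k c -> e \in c -> arc_head k e \in vertices c.
Proof.
by move=> circ_c ce; rewrite inE -(mem_rot 1) -(circuit_heads circ_c) map_f.
Qed.

Lemma verticesP (n : nat) (c : seq (darc n)) (v : 'I_n) :
  reflect (exists b, (v, b) \in c) (v \in vertices c).
Proof.
rewrite inE; apply: (iffP mapP) => [[[w b] cwb ->] | [b cvb]].
  by exists b.
by exists (v, b).
Qed.

Lemma essential_bulletsE (n k : nat) (c : seq (darc n)) (v : 'I_n) :
  circuit k c -> (v \in essential_bullets c) = ((v, true) \in c).
Proof.
move=> circ_c; rewrite inE.
apply/andP/idP => [[/verticesP[[] //= ->] //] | ctrue].
split; first by apply/verticesP; exists true.
by apply/negP => cfalse; have := circuit_tail_inj circ_c ctrue cfalse erefl.
Qed.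

Lemma card_essential_bullets (n k : nat) (c : seq (darc n)) :
  circuit k c -> #|essential_bullets c| = count (@is_row_arc n) c.
Proof.
move=> circ_c; have [_ _ uniq_c] := and3P circ_c.
pose rows := filter (@is_row_arc n) c.
have -> : count (@is_row_arc n) c = size (map (@arc_tail n) rows).
  by rewrite size_map size_filter.
have /card_uniqP <- : uniq (map (@arc_tail n) rows).
  by apply: subseq_uniq uniq_c; apply/map_subseq/filter_subseq.
apply: eq_card => v; rewrite (essential_bulletsE v circ_c).
apply/idP/mapP => [cv | [[w []]]].
  by exists (v, true) => //; rewrite mem_filter.
  by rewrite mem_filter /= => cw ->.
by rewrite mem_filter.
Qed.

(** * Winding numbers *)

(** The signed number of times that the arc passes from [n] to 0. *)
Definition arc_wraps (n k : nat) (e : darc n.+1) : int :=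
  if is_row_arc e then Posz ((arc_tail e + k) %/ n.+1)
  else (- Posz (arc_tail e == ord0))%R.

Lemma arc_head_lift (n k : nat) (e : darc n.+1) :
  (Posz (arc_tail e) + arc_length k e =
   Posz (arc_head k e) + Posz n.+1 * arc_wraps k e)%R.
Proof.
rewrite /arc_length /arc_wraps /arc_head; case: is_row_arc.
  have := divn_eq (arc_tail e + k) n.+1; rewrite val_cadd; lia.
have := ltn_ord (arc_tail e); rewrite -val_eqE /=.
case: eqP => [-> _|ne lt]; first by rewrite add0n /= modn_small //; lia.
have -> : (arc_tail e + n.+1).-1 = (arc_tail e).-1 + n.+1 by lia.
by rewrite modnDr modn_small; lia.
Qed.

(** A row arc from [B] increases the rank by [q]; a reverse short arc crosses no
    element of [B]. In both cases the rank is corrected by [#|B|] for every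
    turn, as the position is corrected by [n + 1] in [arc_head_lift]. *)
Lemma hits_head (n k q : nat) (B : {set 'I_n.+1}) (e : darc n.+1) :
  balanced k B q -> is_row_arc e = (arc_tail e \in B) ->
  (Posz (hits B (arc_tail e).+1) + Posz (q * is_row_arc e) =
   Posz (hits B (arc_head k e).+1) + Posz #|B| * arc_wraps k e)%R.
Proof.
move=> bal; rewrite /arc_wraps /arc_head; case: is_row_arc => tail_e.
  have := bal (arc_tail e); rewrite valZpK => /(_ (esym tail_e)).
  rewrite addSn val_cadd -addn1 hits_divmod addn1; lia.
have Bt : hits B (arc_tail e).+1 = hits B (arc_tail e).
  by rewrite hitsS valZpK -tail_e addn0.
rewrite Bt; have := ltn_ord (arc_tail e); rewrite -val_eqE /=.
case: eqP => [-> _|ne lt].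
  rewrite add0n /= modn_small // hits_period /hits big_ord0.
  by rewrite muln0 mulrN1 [RHS]subrr.
have -> : (arc_tail e + n.+1).-1 = (arc_tail e).-1 + n.+1 by lia.
by rewrite modnDr modn_small ?prednK ?muln0 ?oppr0 ?mulr0 ?addr0; lia.
Qed.

(** Summing [arc_head_lift] and [hits_head] around the circuit cancels the
    positions and the ranks: the same number [w] of turns accounts for the
    total length and for the total increase of rank. *)
Lemma circuit_winding (n k q : nat) (B : {set 'I_n.+1}) (c : seq (darc n.+1)) :
  circuit k c -> balanced k B q ->
  (forall e, e \in c -> is_row_arc e = (arc_tail e \in B)) ->
  exists2 w : int, winding k c = (w%:~R)%R &
    (Posz (q * count (@is_row_arc n.+1) c) = Posz #|B| * w)%R.
Proof.
move=> circ_c bal rowE; exists (\sum_(e <- c) arc_wraps k e)%R.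
  rewrite /winding; have -> : (\sum_(e <- c) arc_length k e =
             Posz n.+1 * \sum_(e <- c) arc_wraps k e)%R.
    rewrite mulr_sumr.
    apply: (addrI (\sum_(e <- c) Posz (arc_tail e))%R).
    rewrite -[in RHS](sum_heads_tails (fun v : 'I_n.+1 => Posz v) circ_c).
    by rewrite -!big_split /=; apply: eq_bigr => e _; exact: arc_head_lift.
  by rewrite intrM -pmulrn mulrC mulKf ?pnatr_eq0.
rewrite -sum1_count big_mkcond big_distrr /=.
rewrite (big_morph _ PoszD (erefl (Posz 0))) mulr_sumr.
apply: (addrI (\sum_(e <- c) Posz (hits B (arc_tail e).+1))%R).
pose rank (v : 'I_n.+1) := Posz (hits B v.+1).
rewrite -[in RHS](sum_heads_tails rank circ_c).
rewrite -!big_split /=; apply: eq_big_seq => e ce.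
by rewrite -(hits_head bal (rowE e ce)); case: is_row_arc.
Qed.

(** * The essential bullets of a family are balanced *)

(** Let [excess y] be the number of elements of [B] among the [k] indices
    following [y]. Going from an element of [B] to the next one moves the start
    of the window past one element and, by hypothesis, its end past at least
    one, so [excess] is nondecreasing on [B]; since it is periodic, it is
    constant. *)
Lemma balanced_of_lt (n k : nat) (B : {set 'I_n.+1}) :
  (forall y z, inZp y \in B -> inZp z \in B -> y < z ->
     hits B (y.+1 + k) < hits B (z.+1 + k)) ->
  exists q, balanced k B q.
Proof.
move=> lt_next; pose excess y := hits B (y.+1 + k) - hits B y.+1.
have le_hits y : hits B y.+1 <= hits B (y.+1 + k) by rewrite leq_hits ?leq_addr.
have mono z y : inZp y \in B -> inZp z \in B -> y <= z -> excess y <= excess z.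
  elim/ltn_ind: z y => z IHz y By Bz.
  rewrite leq_eqVlt => /predU1P[-> // | ltyz].
  have lt_h : hits B y < hits B z by rewrite ltn_hits.
  have [|x [ltxz Bx defx]] := @hits_ivt n B z (hits B z); first by lia.
  have leyx : y <= x.
    rewrite leqNgt -(ltn_hits y Bx) -leqNgt.
    by move: defx; rewrite hitsS Bx; lia.
  apply: leq_trans (IHz x ltxz y By Bx leyx) _.
  have := lt_next x z Bx Bz ltxz.
  by move: (hitsS B z) (le_hits x) (le_hits z); rewrite Bz /excess; lia.
have period y q : excess (y + q * n.+1) = excess y.
  by rewrite /excess -addSn addnAC !hitsDmul subnDr.
case: (set_0Vmem B) => [-> | [b Bb]]; first by exists 0 => y; rewrite inE.
have Bb' : inZp b \in B by rewrite valZpK.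
exists (excess b) => y By; apply/eqP; rewrite -(subnKC (le_hits y)) eqn_add2l.
rewrite -/(excess y) eqn_leq; apply/andP; split.
  by rewrite -(period b y) mono ?inZpDmul //; nia.
by rewrite -(period y b) mono ?inZpDmul //; nia.
Qed.

Lemma family_bulletsP (n k a : nat) (G : 'I_a -> seq (darc n)) (v : 'I_n) :
  (forall i, circuit k (G i)) ->
  reflect (exists i, (v, true) \in G i) (v \in family_bullets G).
Proof.
move=> circ; apply: (iffP bigcupP) => [[i _] | [i Gv]].
  by rewrite (essential_bulletsE v (circ i)); exists i.
by exists i; rewrite // (essential_bulletsE v (circ i)).
Qed.

Lemma vertices_eq (n a : nat) (G : 'I_a -> seq (darc n)) (i j : 'I_a)
    (v : 'I_n) :
  (forall i j, i != j -> [disjoint vertices (G i) & vertices (G j)]) ->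
  v \in vertices (G i) -> v \in vertices (G j) -> i = j.
Proof.
move=> disj vi vj; apply/eqP/negPn/negP => /disj/disjointFr/(_ vi).
by rewrite vj.
Qed.

Lemma card_family_bullets (n k a : nat) (G : 'I_a -> seq (darc n)) :
  (forall i, circuit k (G i)) ->
  (forall i j, i != j -> [disjoint vertices (G i) & vertices (G j)]) ->
  #|family_bullets G| = \sum_(i < a) count (@is_row_arc n) (G i).
Proof.
move=> circ disj; rewrite -sum1_card partition_disjoint_bigcup => [|i j /disj].
  by apply: eq_bigr => i _; rewrite sum1_card (card_essential_bullets (circ i)).
apply: disjointW; apply/subsetP => v; rewrite inE; by case/andP.
Qed.

(** A reverse short arc cannot leave an essential bullet: the row arc leaving it
    would belong to a circuit of the family with a common vertex, hence to the
    same one, where tails are distinct. *)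
Lemma row_arc_family (n k a : nat) (G : 'I_a -> seq (darc n)) (i : 'I_a)
    (e : darc n) :
  (forall i, circuit k (G i)) ->
  (forall i j, i != j -> [disjoint vertices (G i) & vertices (G j)]) ->
  e \in G i -> is_row_arc e = (arc_tail e \in family_bullets G).
Proof.
move=> circ disj; case: e => v b Ge.
apply/idP/(family_bulletsP v circ) => [row | [j Gj]].
  by exists i; move: row Ge; rewrite /is_row_arc /= => ->.
have eqij : i = j.
  apply: (vertices_eq disj (v := v)); apply/verticesP; first by exists b.
  by exists true.
subst j.
by have [-> ] := circuit_tail_inj (circ i) Ge Gj erefl.
Qed.

(** Otherwise no index in [y + k + 1 .. z + k] lies in [B], so the circuit that
    jumps from [z] to [z + k] steps back all the way down to [y + k], where the
    row arc from [y] also ends; two arcs of the family would share a head. *)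
Lemma family_lt_next (n k a : nat) (G : 'I_a -> seq (darc n.+1)) (y z : nat) :
  let B := family_bullets G in
  (forall i, circuit k (G i)) ->
  (forall i j, i != j -> [disjoint vertices (G i) & vertices (G j)]) ->
  inZp y \in B -> inZp z \in B -> y < z ->
  hits B (y.+1 + k) < hits B (z.+1 + k).
Proof.
move=> B circ disj By Bz ltyz; rewrite ltnNge; apply/negP => le_h.
have [i Gz] := family_bulletsP _ circ Bz.
have [j Gy] := family_bulletsP _ circ By.
have notB u : y + k < u <= z + k -> inZp u \notin B.
  move=> /andP[ltu leu]; apply/negP => Bu.
  have := ltn_hits (z.+1 + k) Bu; have := leq_hits B ltu; rewrite -addSn; lia.
have short u e : y + k < u <= z + k -> e \in G i -> arc_head k e = inZp u ->
    (inZp u, false) \in G i.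
  move=> /notB NBu Ge defu; have := arc_head_vertex (circ i) Ge.
  rewrite defu => /verticesP[[] // Gu]; case/negP: NBu.
  by apply/(family_bulletsP _ circ); exists i.
have walk m : m < z - y -> (inZp (z + k - m), false) \in G i.
  elim: m => [|m IHm] ltm.
    by apply: (short _ _ _ Gz); [lia | rewrite subn0 -cadd_inZp].
  apply: (short _ _ _ (IHm (ltnW ltm))); first by lia.
  rewrite /arc_head /=.
  have -> : z + k - m = (z + k - m.+1).+1 by lia.
  exact: ord_pred_inZp.
have := walk (z - y).-1; have -> : z + k - (z - y).-1 = (y + k).+1 by lia.
rewrite prednK ?subn_gt0 // => /(_ (leqnn _)) Gf.
have head_eq : arc_head k (inZp (y + k).+1 : 'I_n.+1, false) =
    arc_head k (inZp y : 'I_n.+1, true).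
  by rewrite /arc_head /= ord_pred_inZp cadd_inZp.
have eqij : i = j.
  apply: (vertices_eq disj (arc_head_vertex (circ i) Gf)).
  by rewrite head_eq (arc_head_vertex (circ j)).
by subst j; have := circuit_head_inj (circ i) Gf Gy head_eq.
Qed.

(** Some excess [q] exists; the winding identity of one circuit with [s/a] row
    arcs and winding number [p/a] reads [q * (s/a) = s * (p/a)], so [q = p]. *)
Lemma family_balanced (n k s p : nat) (G : 'I_(gcdn s p) -> seq (darc n.+1)) :
  0 < s -> circuit_family n.+1 k s p G ->
  #|family_bullets G| = s /\ balanced k (family_bullets G) p.
Proof.
move=> s0 [props disj]; have circ i : circuit k (G i) by case: (props i).
have a0 : 0 < gcdn s p by rewrite gcdn_gt0 s0.
have card_B : #|family_bullets G| = s.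
  rewrite (card_family_bullets circ disj).
  rewrite (eq_bigr (fun=> s %/ gcdn s p)) => [|i _]; last by case: (props i).
  by rewrite sum_nat_const card_ord mulnC divnK ?dvdn_gcdl.
split=> //.
have [q bal] := balanced_of_lt
  (fun y z => @family_lt_next n k _ G y z circ disj).
suff eq_pq : p = q by move=> y By; rewrite (bal y By) -eq_pq.
have [_ rows wind] := props (Ordinal a0).
have [w] := circuit_winding (circ (Ordinal a0)) bal
  (fun e => @row_arc_family _ _ _ _ (Ordinal a0) e circ disj).
have sa0 : 0 < s %/ gcdn s p by rewrite divn_gt0 // dvdn_leq ?dvdn_gcdl.
rewrite wind card_B rows pmulrn => /intr_inj <- [] eq_qs.
apply/eqP; rewrite eq_sym -(eqn_pmul2r sa0) eq_qs.
by rewrite !muln_divA ?dvdn_gcdl ?dvdn_gcdr // mulnC.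
Qed.

(** * A family of circuits through a balanced set *)

(** The only possible successor of [v] in a circuit whose essential bullets lie
    in [B] and whose other vertices do not. *)
Definition tour_step (n k : nat) (B : {set 'I_n}) (v : 'I_n) : 'I_n :=
  if v \in B then cadd v k else ord_pred v.

Definition tour (n k : nat) (B : {set 'I_n}) (b : 'I_n) : seq (darc n) :=
  [seq (v, v \in B) | v <- fingraph.orbit (tour_step k B) b].

Lemma tour_circuit (n k : nat) (B : {set 'I_n}) (b : 'I_n) :
  fcycle (tour_step k B) (fingraph.orbit (tour_step k B) b) ->
  circuit k (tour k B b).
Proof.
move=> cyc; apply/and3P; split.
- by rewrite -size_eq0 size_map size_orbit -lt0n fingraph.order_gt0.
- by rewrite /tour cycle_map.
- by rewrite -map_comp map_id_in // orbit_uniq.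
Qed.

Lemma mem_tour (n k : nat) (B : {set 'I_n}) (b : 'I_n) (e : darc n) :
  (e \in tour k B b) =
  (arc_tail e \in fingraph.orbit (tour_step k B) b) &&
  (is_row_arc e == (arc_tail e \in B)).
Proof.
case: e => v t; apply/mapP/andP => /= [[w ow [-> ->]] // | [ov /eqP ->]].
by exists v.
Qed.

(** The vertices met when stepping back from the landing point [z + k] of a
    jump, down to the first element of [B]; [y] lifts [v] to the line. *)
Definition on_descent (n k : nat) (B : {set 'I_n.+1}) (v : 'I_n.+1) : Prop :=
  exists y z, [/\ inZp y = v, inZp z \in B, y <= z + k
                & hits B y.+1 = hits B (z + k).+1].

Lemma cadd_inj (n r : nat) : injective (fun v : 'I_n => cadd v r).
Proof.
move=> v w /(congr1 val) /=; rewrite !val_cadd => /eqP.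
by rewrite eqn_modDr !modn_small // => /eqP/val_inj.
Qed.

Lemma orbit_on_descent (n k : nat) (B : {set 'I_n.+1}) (b v : 'I_n.+1) :
  b \in B -> v \in fingraph.orbit (tour_step k B) b ->
  v \in B \/ on_descent k B v.
Proof.
move=> Bb; rewrite -fconnect_orbit => /iter_findex <-.
elim: (findex _ _ _) => [|m IHm]; first by left.
rewrite iterS; set w := iter m _ b in IHm *; right.
rewrite /tour_step; case: ifPn => [Bw | NBw].
  exists (w + k), w; split; rewrite ?valZpK //.
  by rewrite -cadd_inZp valZpK.
case: IHm => [Bw | [y [z [defw Bz leyz eqh]]]]; first by rewrite Bw in NBw.
(* One turn ahead, so that the predecessor y + n exists even when y = 0. *)
exists (y + n), (z + n.+1); split; rewrite ?inZpDn //; last 2 first.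
- by lia.
- move: eqh; rewrite hitsS defw (negbTE NBw) addn0 => eqh.
  have -> : (y + n).+1 = y + n.+1 by lia.
  have -> : (z + n.+1 + k).+1 = (z + k).+1 + n.+1 by lia.
  by rewrite !hitsDn eqh.
by rewrite -defw -[in RHS]inZpDn addnS ord_pred_inZp.
Qed.

(** If the jump from [v] landed where [w] steps back to, the descent from
    some [z + k] through [w] would cross no element of [B] before that landing
    point, so the windows after [v] and after [z] would end at the same rank
    although they start at different elements of [B]; balance forbids this. *)
Lemma landing_disjoint (n k p : nat) (B : {set 'I_n.+1}) (v w : 'I_n.+1) :
  k <= n -> balanced k B p -> v \in B -> w \notin B -> on_descent k B w ->
  cadd v k <> ord_pred w.
Proof.
move=> lekn bal Bv NBw [y [z [defw Bz leyz eqh]]] eq_land.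
(* A lift of v, one turn ahead so that k can be subtracted. *)
pose u := y + n - k; pose z' := z + n.+1.
have def_uk : u + k = y + n by rewrite subnK //; lia.
have Bu : inZp u \in B.
  suff -> : inZp u = v by [].
  apply: (@cadd_inj _ k) => /=.
  by rewrite cadd_inZp def_uk eq_land -defw -[in RHS]inZpDn addnS ord_pred_inZp.
have Bz' : inZp z' \in B by rewrite inZpDn.
have ltuz : u < z' by rewrite /z'; lia.
have := bal u Bu; have := bal z' Bz'.
have -> : z'.+1 + k = (z + k).+1 + n.+1 by rewrite /z'; lia.
have -> : u.+1 + k = y + n.+1 by lia.
rewrite !hitsDn -eqh [hits B y.+1]hitsS defw (negbTE NBw) addn0.
have := leq_hits B ltuz; have := hitsS B z'; rewrite Bz'; lia.
Qed.

(** Injectivity along an orbit makes it a cycle; jumps and short steps are each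
    injective, and [landing_disjoint] excludes the mixed case. *)
Lemma tour_closed (n k p : nat) (B : {set 'I_n.+1}) (b : 'I_n.+1) :
  k <= n -> balanced k B p -> b \in B ->
  fcycle (tour_step k B) (fingraph.orbit (tour_step k B) b).
Proof.
move=> lekn bal Bb; apply/(orbitPcycle 5 0) => v w ov ow.
have tail x : x \in fingraph.orbit (tour_step k B) b -> x \notin B ->
      on_descent k B x.
  by move=> /(orbit_on_descent Bb)[-> |].
rewrite /tour_step; case: ifPn => Bv; case: ifPn => Bw.
- exact: cadd_inj.
- by move/(landing_disjoint lekn bal Bv Bw (tail w ow Bw)).
- by move/esym/(landing_disjoint lekn bal Bw Bv (tail v ov Bv)).
- exact: ord_pred_inj.
Qed.

(** Both kinds of step change the rank by a combination of [p] and [#|B|]. *)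
Lemma hits_mod_orbit (n k p d : nat) (B : {set 'I_n.+1}) (b v : 'I_n.+1) :
  balanced k B p -> d %| #|B| -> d %| p ->
  v \in fingraph.orbit (tour_step k B) b ->
  hits B b.+1 = hits B v.+1 %[mod d].
Proof.
move=> bal dvdB dvdp; rewrite -fconnect_orbit.
pose rank (u : 'I_n.+1) := hits B u.+1 %% d.
apply: (@fconnect_invariant _ _ _ rank) => {}v; rewrite /rank /=.
have := hits_head (e := (v, v \in B)) bal erefl.
rewrite /arc_head /is_row_arc /= -/(tour_step k B v) => eqh.
rewrite -eqz_nat -!modz_nat eqz_mod_dvd.
have solve (x y z t : int) : (x + y = z + t -> z - x = y - t)%R by lia.
rewrite (solve _ _ _ _ eqh).
by rewrite rpredB //= ?dvdz_mulr // dvdzE /= dvdn_mulr.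
Qed.

(** The tours of the first [gcd(s, p)] elements of [B] are disjoint because the
    rank modulo [gcd(s, p)] is constant along each of them. The winding
    identity bounds the number of row arcs of each from below, and the
    cardinal of [B] bounds their sum from above by the same total. *)
Lemma balanced_family (n k s p : nat) (B : {set 'I_n.+1}) :
  k <= n -> 0 < s -> #|B| = s -> balanced k B p ->
  exists G : 'I_(gcdn s p) -> seq (darc n.+1), circuit_family n.+1 k s p G.
Proof.
move=> lekn s0 cardB bal; set a := gcdn s p.
have a0 : 0 < a by rewrite gcdn_gt0 s0.
have /fin_all_exists[b bP] (i : 'I_a) : exists b, b \in B /\ hits B b.+1 = i.+1.
  have [|y [lty By defy]] := @hits_ivt n B n.+1 i.+1.
    rewrite hits_period cardB /= (leq_trans (ltn_ord i)) //.
    by rewrite dvdn_leq ?dvdn_gcdl.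
  by exists (inZp y); rewrite By /= modn_small.
pose G i := tour k B (b i); exists G.
have circ i : circuit k (G i).
  by apply: tour_circuit; apply: tour_closed bal _; case: (bP i).
have rowE i e : e \in G i -> is_row_arc e = (arc_tail e \in B).
  by rewrite mem_tour => /andP[_ /eqP].
have disj i j : i != j -> [disjoint vertices (G i) & vertices (G j)].
  move=> neq; rewrite disjoint_subset; apply/subsetP => v /verticesP[t].
  rewrite mem_tour inE => /andP[/= oi _]; apply/negP => /verticesP[t'].
  rewrite mem_tour => /andP[/= oj _]; case/negP: neq.
  apply/eqP/val_inj/eqP => /=.
  have [_ hi] := bP i; have [_ hj] := bP j.
  rewrite -(modn_small (ltn_ord i)) -[X in _ == X](modn_small (ltn_ord j)).
  rewrite -(eqn_modDr 1) !addn1 -hi -hj.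
  have dvdB : a %| #|B| by rewrite cardB dvdn_gcdl.
  have dvdp : a %| p by exact: dvdn_gcdr.
  rewrite (hits_mod_orbit bal dvdB dvdp oi).
  by rewrite (hits_mod_orbit bal dvdB dvdp oj).
pose rows i := count (@is_row_arc n.+1) (G i).
have sE : s %/ a * a = s by rewrite divnK ?dvdn_gcdl.
have pE : p %/ a * a = p by rewrite divnK ?dvdn_gcdr.
have turns i : exists2 w : int, winding k (G i) = (w%:~R)%R &
    Posz (p * rows i) = (Posz s * w)%R.
  by have := circuit_winding (circ i) bal (rowE i); rewrite cardB.
have le_rows i : s %/ a <= rows i.
  have rows0 : 0 < rows i.
    rewrite -has_count; apply/hasP; exists (b i, true) => //.
    by have [Bb _] := bP i; rewrite mem_tour in_orbit /= Bb.
  apply: dvdn_leq => //; have [w _ eqw] := turns i.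
  have : (Posz s %| Posz (p * rows i))%Z by rewrite eqw dvdz_mulr.
  rewrite dvdzE !absz_nat.
  rewrite -{1}sE -{1}pE mulnAC dvdn_pmul2r // Gauss_dvdr //.
  by rewrite /coprime -(eqn_pmul2r a0) muln_gcdl sE pE mul1n.
have sum_rows : \sum_(i < a) rows i <= \sum_(i < a) s %/ a.
  rewrite sum_nat_const card_ord mulnC sE -cardB.
  rewrite -(card_family_bullets circ disj).
  apply: subset_leq_card; apply/subsetP => v /(family_bulletsP v circ)[i /rowE].
  by move=> <-.
have rows_eq i : rows i = s %/ a.
  have /geq_leqif := leqif_sum (fun i (_ : true) => leqif_eq (le_rows i)).
  by rewrite sum_rows => /esym/forallP/(_ i)/eqP.
split=> // i; split=> //; first exact: rows_eq.
have [w ->] := turns i.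
rewrite rows_eq muln_divA ?dvdn_gcdl // mulnC -muln_divA ?dvdn_gcdr //.
by rewrite PoszM => /(mulfI _) <-; rewrite ?pmulrn // eqz_nat -lt0n.
Qed.

(** * Circulant minors and families of circuits *)

Theorem corollary4p8 (n k : nat) (hk2 : 2 <= k) (hkn : k <= n - 1)
    (s p : nat) (hp2 : 2 <= p) (hps : p <= s - 1) :
  ((exists N : {set 'I_n},
      mx_isomorphic (mx_minor (circulant n k) N) (circulant s p))
   <->
   (exists G : 'I_(gcdn s p) -> seq (darc n), circuit_family n k s p G))
  /\
  (forall G : 'I_(gcdn s p) -> seq (darc n),
     circuit_family n k s p G ->
     mx_isomorphic (mx_minor (circulant n k) (~: family_bullets G))
                   (circulant s p)).
Proof.
case: n hkn => [|n]; first by lia.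
rewrite subn1 /= => lekn; have lt0ps : 0 < p < s by lia.
have s0 : 0 < s by lia.
have minor_of_family (G : 'I_(gcdn s p) -> seq (darc n.+1)) :
    circuit_family n.+1 k s p G ->
    mx_isomorphic (mx_minor (circulant n.+1 k) (~: family_bullets G))
                  (circulant s p).
  move=> famG; apply/minor_circulantP; rewrite // setCK.
  exact: family_balanced.
split=> //; split=> [[N] | [G famG]].
  move=> /(minor_circulantP N lekn lt0ps)[cardB bal].
  exact: balanced_family cardB bal.
by exists (~: family_bullets G); exact: minor_of_family.
Qed.
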